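(* Let $a,b\in\mathbb{R}$ and let $z=(z_0,z_1,z_2,z_3,z_4)$ be the signal $z_t=a+bt$ for $t=0,\ldots,4$. Then the centered first-degree F-transform coefficient of $z$ satisfies $\beta_2^1[z]=b$.
   Context: For a five-point real signal $z=(z_0,z_1,z_2,z_3,z_4)$, the centered first-degree F-transform coefficient is $$\beta_2^1[z]=\frac{\sum_{t=0}^4 z_t(t-c_2)A_2(t)}{\sum_{t=0}^4 (t-c_2)^2A_2(t)},$$ where $c_2=2$, $h=2$, and $A_2(t)=\max\left(0,\,1-\frac{|t-c_2|}{h}\right)$. *)

(* Defs.v *)
From mathcomp Require Import all_boot all_order all_algebra.
From mathcomp Require Import reals.

Set Implicit Arguments.
Unset Strict Implicit.
Unset Printing Implicit Defensive.

Import Order.TTheory GRing.Theory Num.Theory.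
Local Open Scope ring_scope.

Definition c2 (R : realType) : R := 2.

Definition h (R : realType) : R := 2.

Definition A2 (R : realType) (t : R) : R :=
  Num.max 0 (1 - `|t - c2 R| / h R).

Definition beta21 (R : realType) (z : 'I_5 -> R) : R :=
  (\sum_(t < 5) z t * (t%:R - c2 R) * A2 t%:R)
  / (\sum_(t < 5) (t%:R - c2 R) ^+ 2 * A2 t%:R).

(* Main.v *)
Require Import Defs.
From mathcomp Require Import all_boot all_order all_algebra.
From mathcomp Require Import reals.
From mathcomp Require Import ring lra.

(** Rewriting the line around the centre, [a + b t = (a + 2 b) + b (t - 2)],
    turns the numerator of the coefficient into [a + 2 b] times the first
    centred moment of the weights plus [b] times the second one.  The first
    moment vanishes because the weights are symmetric about the centre
    ([first_moment_A2]); the second moment is the denominator, and it is nonzero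
    because the weights are nonnegative and positive at the off-centre node
    [t = 1] ([second_moment_A2_gt0]).  The quotient is therefore [b]. *)

Set Implicit Arguments.
Unset Strict Implicit.
Unset Printing Implicit Defensive.

Import Order.TTheory GRing.Theory Num.Theory.
Local Open Scope ring_scope.

Lemma A2_ge0 (R : realType) (t : R) : 0 <= A2 t.
Proof. by rewrite /A2 le_max lexx. Qed.

Lemma A2_sym (R : realType) (t : R) : A2 (4 - t) = A2 t.
Proof.
rewrite /A2 /c2; have -> : 4 - t - 2 = - (t - 2) by ring.
by rewrite normrN.
Qed.

(** Reversing the nodes, [t |-> 4 - t], preserves the weights and negates
    [t - 2], so the moment equals its own opposite. *)
Lemma first_moment_A2 (R : realType) :
  \sum_(t < 5) (t%:R - c2 R) * A2 t%:R = 0.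
Proof.
set S := LHS; suff : S = - S by lra.
rewrite {1}/S (reindex_inj rev_ord_inj) /= -sumrN.
apply: eq_bigr => t _.
rewrite subSS natrB; last by rewrite -ltnS.
by rewrite A2_sym -mulNr /c2; congr (_ * _); ring.
Qed.

Lemma second_moment_A2_gt0 (R : realType) :
  0 < \sum_(t < 5) (t%:R - c2 R) ^+ 2 * A2 t%:R.
Proof.
rewrite (bigD1 (Ordinal (isT : (1 < 5)%N))) //=.
apply: ltr_wpDr.
  by apply: sumr_ge0 => t _; rewrite mulr_ge0 ?sqr_ge0 ?A2_ge0.
rewrite /A2 /c2 /h; have -> : 1%:R - 2 = - 1 :> R by ring.
by rewrite normrN1 sqrrN expr1n !mul1r lt_max; apply/orP; right; lra.
Qed.

Theorem proposition3p4 (R : realType) (a b : R) (z : 'I_5 -> R)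
  (hz : forall t : 'I_5, z t = a + b * t%:R) :
  beta21 z = b.
Proof.
rewrite /beta21; set M := (X in _ / X).
suff -> : \sum_(t < 5) z t * (t%:R - c2 R) * A2 t%:R = b * M.
  by rewrite mulfK // gt_eqF // second_moment_A2_gt0.
have -> : b * M = (a + b * c2 R) *
    (\sum_(t < 5) (t%:R - c2 R) * A2 t%:R) + b * M.
  by rewrite first_moment_A2 mulr0 add0r.
rewrite /M !mulr_sumr -big_split /=.
by apply: eq_bigr => t _; rewrite hz; ring.
Qed.
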